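(* Assume the following: (i) the parameter space $\mathcal{R}_o$ of the reward MLP is contained in a Euclidean ($\ell_2$) ball $B(r_o,s_1)$ of radius $s_1$ around a point $r_o$; (ii) the parameter space $\Theta$ of the VAE decoder is contained in an $\ell_2$ ball $B(\theta_0,s_2)$ of radius $s_2$ around a point $\theta_0$; (iii) the best possible reward function $r_o^*:\mathbb{R}^d\to\mathbb{R}$ is $\alpha$-Hölder continuous with exponent $\alpha\in(0,1]$ and constant $L_r>0$, i.e. $|r_o^*(\mathbf{e}_1)-r_o^*(\mathbf{e}_2)|\le L_r\|\mathbf{e}_1-\mathbf{e}_2\|^{\alpha}$ for all $\mathbf{e}_1,\mathbf{e}_2\in\mathbb{R}^d$; (iv) the VAE decoder $g_\theta:\mathbb{R}^{d_{\mathrm{VAE}}}\to\mathbb{R}^d$ is $L_g$-Lipschitz with respect to the latent-space norm, with $L_g>0$, i.e. $\|g_\theta(\mathbf{z}_1)-g_\theta(\mathbf{z}_2)\|\le L_g\|\mathbf{z}_1-\mathbf{z}_2\|$ for all $\mathbf{z}_1,\mathbf{z}_2$; (v) $\sup_{(\mathbf{z},\mathbf{e})\in\mathcal{Z}\times\mathcal{E}}\|g_\theta(q_\phi(\mathbf{z}|\mathbf{e}))-\mathbf{e}\|\le\epsilon_{\mathrm{rec}}$, where $g_\theta(q_\phi(\mathbf{z}|\mathbf{e}))$ denotes the decoder output $g_\theta(\mathbf{z})$ at a latent vector $\mathbf{z}$ of $\mathbf{e}$ sampled from the encoder posterior $q_\phi(\cdot\mid\mathbf{e})$; (vi) $\epsilon_{\mathrm{rec}}=\mathcal{O}(N^{-p})$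 for some $p>0$, where $N$ is the size of the original preference dataset. Let $\delta\in(0,1)$. Then, with probability at least $1-\delta$, for any synthesized preference embedding pair $(\hat{\mathbf{e}}^+,\hat{\mathbf{e}}^-)$, the reward difference evaluated by the best possible reward MLP function $r_o^*$ is lower bounded by $$r_o^*(\hat{\mathbf{e}}^+)-r_o^*(\hat{\mathbf{e}}^-)\;\ge\; r_o^*(\mathbf{e}^+)-r_o^*(\mathbf{e}^-)\;-\;2L_r\bigl(L_g t_\delta+\epsilon_{\mathrm{rec}}\bigr)^{\alpha},$$ where $(\mathbf{e}^+,\mathbf{e}^-)$ is the corresponding original preference embedding pair from which $(\hat{\mathbf{e}}^+,\hat{\mathbf{e}}^-)$ is synthesized, and $$t_\delta:=\sigma_{\mathrm{noise}}\sqrt{d_{\mathrm{VAE}}+2\sqrt{d_{\mathrm{VAE}}\ln(4/\delta)}+2\ln(4/\delta)},$$ with $d_{\mathrm{VAE}}$ the dimension of the VAE latent space and $\sigma_{\mathrm{noise}}$ the magnitude of the noise added in the latent space.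
   Context: Preference embeddings are vectors in $\mathbb{R}^d$; an original preference pair $(\mathbf{e}^+,\mathbf{e}^-)$ consists of the embeddings of a preferred and a non-preferred response. $\mathcal{E}=\{\mathbf{e}_i^+,\mathbf{e}_i^-\}_{i=1}^N$ is the original preference dataset, and $\mathcal{P}_e$ is the distribution of original preference embedding pairs. All norms are Euclidean. A variational autoencoder (VAE) with latent dimension $d_{\mathrm{VAE}}$ and latent space $\mathcal{Z}$ (in $\mathbb{R}^{d_{\mathrm{VAE}}}$) consists of an encoder, mapping an embedding $\mathbf{e}$ to a diagonal Gaussian posterior $q_\phi(\cdot\mid\mathbf{e})$ on $\mathbb{R}^{d_{\mathrm{VAE}}}$, and a deterministic decoder $g_\theta:\mathbb{R}^{d_{\mathrm{VAE}}}\to\mathbb{R}^d$ with parameter $\theta\in\Theta$. The latent vector $\mathbf{z}^\pm$ of $\mathbf{e}^\pm$ is drawn from $q_\phi(\cdot\mid\mathbf{e}^\pm)$. Synthesized embeddings are obtained by perturbing latent vectors with Gaussian noise and decoding: $\hat{\mathbf{e}}^{\pm}=g_\theta(\mathbf{z}^{\pm}+\boldsymbol{\eta}^{\pm})$ with $\boldsymbol{\eta}^{\pm}\sim\mathcal{N}(0,\sigma_{\mathrm{noise}}^2\mathbf{I})$ in $\mathbb{R}^{d_{\mathrm{VAE}}}$. Several noise draws may be made for each original embedding, and in the procedure only the $k$ perturbed latent vectors of highest likelihood under the learned distributions are kept for decoding. The best possible reward function is $r_o^*=\operatorname{argmin}_{r_o\in\mathcal{R}_o}\mathbb{E}_{(\mathbf{e}^+,\mathbf{e}^-)\sim\mathcal{P}_e}\left[-\log\sigma\bigl(r_o(\mathbf{e}^+)-r_o(\mathbf{e}^-)\bigr)\right]$,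 where $\sigma(t)=1/(1+e^{-t})$ and $\mathcal{R}_o$ is the hypothesis space of reward MLP functions $\mathbb{R}^d\to\mathbb{R}$ (identified with its parameter space). *)

(* Defs.v *)
From mathcomp Require Export all_boot all_order all_algebra.
From mathcomp Require Export all_classical all_reals all_analysis.

Set Implicit Arguments.
Unset Strict Implicit.
Unset Printing Implicit Defensive.

Import Order.TTheory GRing.Theory Num.Theory.
Import numFieldNormedType.Exports.

Local Open Scope classical_set_scope.
Local Open Scope ring_scope.

(* The norm that the library puts on matrices is the sup norm, so the Euclidean
   norm is defined here. *)
Definition enorm (R : realType) (n : nat) (x : 'rV[R]_n) : R :=
  Num.sqrt (\sum_(i < n) x ord0 i ^+ 2).

Definition eball (R : realType) (n : nat) (c : 'rV[R]_n) (s : R) :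
    set 'rV[R]_n :=
  [set x | enorm (x - c) <= s].

(* Tuples carry the product (= Borel) sigma-algebra, row vectors carry none:
   random vectors and laws on R^n live on [n.-tuple R] and are read as row
   vectors through [vec]. *)
Definition vec (R : realType) (n : nat) (x : n.-tuple R) : 'rV[R]_n :=
  \row_i tnth x i.

(* N(m, s^2); [normal_prob m 0] is the uniform law on [0, 1], hence the
   separate case s = 0. *)
Definition normal_law (R : realType) (m s : R) : set R -> \bar R :=
  if s == 0 then \d_m else normal_prob m s.

(* mu = N(m, diag(s_1^2, ..., s_n^2)); its values on measurable boxes determine
   a probability measure on R^n. *)
Definition diag_normal (R : realType) (n : nat) (m s : 'rV[R]_n)
    (mu : probability (n.-tuple R) R) : Prop :=
  forall A : 'I_n -> set R, (forall i, measurable (A i)) ->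
    mu [set x | forall i, A i (tnth x i)] =
    (\prod_(i < n) normal_law (m ord0 i) (s ord0 i) (A i))%E.

Definition has_law (R : realType) (d d' : measure_display)
    (T : measurableType d) (T' : measurableType d') (P : probability T R)
    (X : {RV P >-> T'}) (mu : probability T' R) : Prop :=
  forall A, measurable A -> distribution P X A = mu A.

(* Number of parameters of a fully connected network with n inputs, hidden
   layers of widths ws and one output: an affine layer from n to k units has
   n * k weights and k biases. *)
Fixpoint mlp_size (n : nat) (ws : seq nat) : nat :=
  if ws is k :: ws' then (n * k + k) + mlp_size k ws' else n * 1 + 1.

Definition affine_layer (R : realType) (n k : nat) (p : 'rV[R]_(n * k + k))
    (x : 'rV[R]_n) : 'rV[R]_k :=
  x *m vec_mx (lsubmx p) + rsubmx p.

Fixpoint mlp (R : realType) (act : R -> R) (n : nat) (ws : seq nat) :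
    'rV[R]_(mlp_size n ws) -> 'rV[R]_n -> R :=
  match ws return 'rV[R]_(mlp_size n ws) -> 'rV[R]_n -> R with
  | [::] => fun p x => affine_layer p x ord0 ord0
  | k :: ws' => fun p x =>
      mlp act (rsubmx p) (map_mx act (affine_layer (lsubmx p) x))
  end.

Definition sigmoid (R : realType) (t : R) : R := (1 + expR (- t))^-1.

Definition preference_risk (R : realType) (d : nat)
    (Pe : probability (d.-tuple R * d.-tuple R)%type R)
    (r : 'rV[R]_d -> R) : \bar R :=
  (\int[Pe]_x (- ln (sigmoid (r (vec x.1) - r (vec x.2))))%:E)%E.

Definition is_argmin (R : realType) (W : Type) (S : set W) (F : W -> \bar R)
    (w : W) : Prop :=
  S w /\ forall v, S v -> (F w <= F v)%E.

Definition preference_dataset (R : realType) (d N : nat)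
    (ep em : 'I_N -> 'rV[R]_d) : set 'rV[R]_d :=
  range ep `|` range em.

Definition t_delta (R : realType) (sigma_noise delta : R) (dVAE : nat) : R :=
  sigma_noise * Num.sqrt (dVAE%:R + 2 * Num.sqrt (dVAE%:R * ln (4 / delta))
                          + 2 * ln (4 / delta)).

(* Main.v *)
(* On an event where both latent vectors decode within eps_rec of their
   originals (almost sure) and both noise vectors have norm at most t_delta, the
   Lipschitz decoder puts each synthesized embedding within L_g t_delta + eps_rec
   of its original, and the Hoelder bound applied twice gives the inequality.

   The noise norm is controlled by Chernoff's method: for a >= 1, the function
   exp ((1 - a^-2) x^2 / (2 s^2)) has mean a under N(0, s^2), because its product
   with the density of N(0, s^2) is a times the density of N(0, (a s)^2).  Hence
   P (|eta|^2 > s^2 n a^2) <= a^n exp (- n (a^2 - 1) / 2).  With y = sqrt (x / n)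
   and a^2 = 1 + 2 y + 2 y^2 <= exp (2 y), the bound becomes exp (- x), and
   s^2 n a^2 = s^2 (n + 2 sqrt (n x) + 2 x).  Taking x = ln (4 / delta) for each
   of the two noise vectors leaves a total failure probability of delta / 2. *)
Require Import Defs.
From mathcomp Require Import measurable_realfun.
From mathcomp Require Import ring lra.
Import Order.TTheory GRing.Theory Num.Theory.
Import numFieldNormedType.Exports.
Import HBNNSimple.

Local Open Scope classical_set_scope.
Local Open Scope ring_scope.

(** * Integration against laws known on boxes *)

(** The hypothesis on sets [A] says that the pushforward along [X] of the measure with density [G]
    is [c] times [nu]. Linearity extends this to simple functions, and monotone convergence to
    nonnegative ones. *)
Lemma ge0_integral_weighted (R : realType) (d d' : measure_display)
    (T : measurableType d) (T' : measurableType d')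
    (mu : {measure set T -> \bar R}) (nu : {measure set T' -> \bar R})
    (X : T -> T') (G : T -> R) (c : R) :
  measurable_fun setT X -> measurable_fun setT G ->
  (forall x, 0 <= G x) -> 0 <= c ->
  (forall A, measurable A ->
     \int[mu]_x (G x * \1_A (X x))%:E = c%:E * nu A)%E ->
  forall f : T' -> \bar R, measurable_fun setT f -> (forall y, 0 <= f y)%E ->
  (\int[mu]_x ((G x)%:E * f (X x)) = c%:E * \int[nu]_y f y)%E.
Proof.
move=> mX mG G0 c0 GA f mf f0.
have mGe : measurable_fun setT (EFin \o G) by exact/measurable_EFinP.
have simple (h : {nnsfun T' >-> R}) :
    (\int[mu]_x ((G x)%:E * (h (X x))%:E) = c%:E * \int[nu]_y (h y)%:E)%E.
  have mh (k : R) : measurable (h @^-1` [set k]) by [].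
  have m1 (k : R) : measurable_fun setT
      (fun x => (\1_(h @^-1` [set k]) (X x) : R)%:E).
    by apply/measurable_EFinP; apply: measurableT_comp => //.
  transitivity (\sum_(k \in range h) \int[mu]_x
      ((G x)%:E * (k * \1_(h @^-1` [set k]) (X x))%:E))%E.
    rewrite -ge0_integral_fsum//.
    - apply: eq_integral => x _; rewrite fimfunE -fsumEFin// ge0_mule_fsumr//.
      by move=> k; rewrite nnfun_muleindic_ge0.
    - move=> k; apply: emeasurable_funM => //.
      apply/measurable_EFinP; apply: measurable_funM => //.
      by apply: measurableT_comp.
    - by move=> k x _; rewrite mule_ge0 ?lee_fin// -lee_fin nnfun_muleindic_ge0.
  transitivity (\sum_(k \in range h) c%:E * \int[nu]_y
      (k * \1_(h @^-1` [set k]) y)%:E)%E; last first.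
    rewrite -ge0_mule_fsumr; last first.
      by move=> k; apply: integral_ge0 => x _; rewrite nnfun_muleindic_ge0.
    congr (_ * _)%E; rewrite -ge0_integral_fsum//.
    - by apply: eq_integral => y _; rewrite fsumEFin// -fimfunE.
    - by move=> k; exact/measurable_EFinP/measurable_funM.
    - by move=> k y _; rewrite nnfun_muleindic_ge0.
  apply: eq_fsbigr => k _.
  (* A nonnegative [h] never takes a value [k < 0], so both sides vanish; only [k >= 0] may be
     pulled out of the integrals. *)
  have [k0|k0] := leP 0 k; last first.
    rewrite preimage_nnfun0// indic0.
    under eq_integral do rewrite /= mulr0 mule0.
    under [in RHS]eq_integral do rewrite /= mulr0.
    by rewrite !integral0 mule0.
  under eq_integral do rewrite EFinM muleCA.
  under [in RHS]eq_integral do rewrite EFinM.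
  rewrite !ge0_integralZl//.
  - by rewrite [in RHS]integral_indic// setIT [in RHS]muleCA -GA//.
  - exact: emeasurable_funM.
  - by move=> x _; rewrite mule_ge0// lee_fin.
  - exact/measurable_EFinP.
have f0' y : setT y -> (0 <= f y)%E by [].
pose f_ := nnsfun_approx measurableT mf.
have nd y : {homo (fun n => (f_ n y)%:E) : n m / (n <= m)%N >-> (n <= m)%E}.
  by move=> m n mn; rewrite lee_fin; exact/lefP/nd_nnsfun_approx.
have cvf y : (fun n => (f_ n y)%:E) @ \oo --> f y.
  exact: cvg_nnsfun_approx.
transitivity (limn (fun n => \int[mu]_x ((G x)%:E * (f_ n (X x))%:E)))%E.
  rewrite -monotone_convergence//.
  - apply: eq_integral => x _; apply/esym/cvg_lim => //.
    exact: cvgeZl.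
  - move=> n; apply: emeasurable_funM => //; apply/measurable_EFinP.
    exact: measurableT_comp.
  - by move=> n x _; rewrite mule_ge0// lee_fin.
  - by move=> x _ m n mn; rewrite lee_wpmul2l ?lee_fin// -lee_fin nd.
under eq_fun do rewrite simple.
apply/cvg_lim => //; apply: cvgeZl => //.
under [X in _ --> X]eq_integral do rewrite -(cvg_lim _ (cvf _))//.
apply: cvg_monotone_convergence => //.
- by move=> n; exact/measurable_EFinP.
- by move=> n y _; rewrite lee_fin.
Qed.

Lemma measurable_box (R : realType) (n : nat) (A : 'I_n -> set R) :
  (forall i, measurable (A i)) ->
  measurable [set x : n.-tuple R | forall i, A i (tnth x i)].
Proof.
move=> mA; rewrite [X in measurable X](_ : _ =
    \big[setI/setT]_(i < n) ((@tnth _ _ ^~ i) @^-1` A i)).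
  apply: bigsetI_measurable => i _; rewrite -[X in measurable X]setTI.
  exact: measurable_tnth.
rewrite -bigcap_seq; apply/seteqP; split => [x xA i _|x xA i]; first exact: xA.
by apply: xA; rewrite /= mem_index_enum.
Qed.

(** Plays the part of Fubini for independent coordinates, working straight from the values of [mu]
    on boxes, which is how [diag_normal] specifies a law. *)
Lemma integral_prod_box (R : realType) (n : nat)
    (mu : {measure set (n.-tuple R) -> \bar R}) 
    (nu : 'I_n -> probability (measurableTypeR R) R) :
  (forall A : 'I_n -> set R, (forall i, measurable (A i)) ->
     mu [set x | forall i, A i (tnth x i)] = \prod_(i < n) nu i (A i))%E ->
  forall (f : 'I_n -> R -> R) (M : 'I_n -> R),
  (forall i, measurable_fun setT (f i)) -> (forall i x, 0 <= f i x) ->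
  (forall i, \int[nu i]_x (f i x)%:E = (M i)%:E)%E ->
  (\int[mu]_x (\prod_(i < n) f i (tnth x i))%:E = (\prod_(i < n) M i)%:E)%E.
Proof.
move=> box.
(* One coordinate at a time: f i is arbitrary for i < k, an indicator otherwise. *)
suff H k : forall (f : 'I_n -> R -> R) (M : 'I_n -> R),
    (forall i, measurable_fun setT (f i)) -> (forall i x, 0 <= f i x) ->
    (forall i, \int[nu i]_x (f i x)%:E = (M i)%:E)%E ->
    (forall i : 'I_n, (k <= i)%N -> exists2 A, measurable A & f i = \1_A) ->
    (\int[mu]_x (\prod_(i < n) f i (tnth x i))%:E = (\prod_(i < n) M i)%:E)%E.
  by move=> f M mf f0 fM; apply: (H n) => // i; rewrite leqNgt ltn_ord.
elim: k => [|k IH] f M mf f0 fM fA.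
  have {}fA i : exists A, measurable A /\ f i = \1_A.
    by have [A mA fiA] := fA i (leq0n _); exists A.
  pose A i := sval (cid (fA i)).
  have mA i : measurable (A i) by rewrite /A; case: cid => ? [].
  have fE i : f i = \1_(A i) by rewrite /A; case: cid => ? [].
  have mbox : measurable [set x : n.-tuple R | forall i, A i (tnth x i)]
    by exact: measurable_box.
  transitivity (\int[mu]_x
      (\1_[set x : n.-tuple R | forall i, A i (tnth x i)] x)%:E)%E.
    apply: eq_integral => x _; congr EFin.
    rewrite indicE; case: (boolP (x \in _)) => [|/negP]; rewrite inE => /= xA.
      by apply: big1 => i _; rewrite fE indicE mem_set.
    move: xA => /existsNP[i xAi].
    by rewrite (bigD1 i)//= fE indicE memNset// mul0r.
  rewrite integral_indic// setIT box// -prodEFin; apply: eq_bigr => i _.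
  by rewrite -fM fE integral_indic ?setIT//; exact: mA.
have [nk|kn] := leqP n k.
  by apply: IH => // i ki; have := ltn_ord i; rewrite ltnNge (leq_trans nk).
pose j := Ordinal kn.
have M0 i : 0 <= M i.
  by rewrite -lee_fin -fM; apply: integral_ge0 => x _; rewrite lee_fin.
rewrite (bigD1 j)//= EFinM muleC -fM.
(* Take [tnth] at [j] as the map and the product of the other factors as the weight. It then
   suffices to treat an indicator in place of [f j], which is the induction hypothesis. *)
rewrite -(@ge0_integral_weighted _ _ _ _ _ mu (nu j) (@tnth _ _ ^~ j)
  (fun x => \prod_(i < n | i != j) f i (tnth x i))) //.
- by apply: eq_integral => x _; rewrite (bigD1 j)//= EFinM muleC.
- exact: measurable_tnth.
- rewrite [X in measurable_fun _ X](_ : _ = fun x : n.-tuple R =>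
      \prod_(i <- [seq i <- index_enum 'I_n | i != j]) f i (tnth x i)); last first.
    by apply/funext => x; rewrite big_filter.
  apply: measurable_prod => i _.
  by apply: (measurableT_comp (mf i)); exact: measurable_tnth.
- by move=> x; apply: prodr_ge0 => i _.
- exact: prodr_ge0.
- move=> A mA.
  pose f' i := if i == j then \1_A else f i.
  pose M' i := if i == j then fine (nu j A) else M i.
  have := IH f' M'; rewrite (bigD1 j)//= [X in (X * _)%:E]/M' eqxx.
  rewrite [X in (_ * X)%:E](eq_bigr M); last by move=> i /negbTE; rewrite /M' => ->.
  rewrite EFinM fineK ?fin_num_measure// muleC => <-.
  + apply: eq_integral => x _; rewrite [in RHS](bigD1 j)//= /f' eqxx mulrC.
    by congr (_ * _)%:E; apply: eq_bigr => i /negbTE ->.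
  + by move=> i; rewrite /f'; case: ifP.
  + by move=> i x; rewrite /f'; case: ifP.
  + move=> i; rewrite /f' /M'; case: eqP => [->|//].
    by rewrite integral_indic// setIT fineK// fin_num_measure.
  + move=> i ki; rewrite /f'; case: eqP => [_|/eqP ij]; first by exists A.
    apply: fA; rewrite ltn_neqAle ki andbT.
    by apply: contra ij => /eqP ?; apply/eqP/val_inj.
- by apply/measurable_EFinP; exact: mf.
- by move=> y; rewrite lee_fin.
Qed.

(** * Exponential moment of a squared Gaussian *)

Lemma integral_normal_prob_expR_sqr (R : realType) (s a : R) : 0 < s -> 0 < a ->
  (\int[normal_prob 0 s]_x (expR ((1 - a ^- 2) / (s ^+ 2 *+ 2) * x ^+ 2))%:E
   = a%:E)%E.
Proof.
move=> s0 a0.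
have mf : measurable_fun (setT : set (measurableTypeR R))
    (fun x : R => (expR ((1 - a ^- 2) / (s ^+ 2 *+ 2) * x ^+ 2))%:E).
  apply/measurable_EFinP; apply: measurableT_comp => //.
  exact: measurable_funM.
(* With [c = 1] and the density as weight, the integral becomes one against Lebesgue measure. *)
rewrite -[LHS]mul1e.
rewrite -(@ge0_integral_weighted _ _ _ _ _ lebesgue_measure
    (normal_prob 0 s) id (normal_pdf 0 s)) //; last 3 first.
- exact: measurable_normal_pdf.
- by move=> x; exact: normal_pdf_ge0.
- move=> A mA; rewrite mul1e /= /normal_prob [in RHS]integral_mkcond.
  by apply: eq_integral => x _; rewrite epatch_indic EFinM.
have as0 : a * s != 0 by rewrite mulf_neq0// gt_eqF.
transitivity (\int[lebesgue_measure]_x (a%:E * (normal_pdf 0 (a * s) x)%:E))%E.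
  apply: eq_integral => x _; rewrite -!EFinM; congr EFin.
  rewrite !normal_pdfE// ?gt_eqF//= /normal_fun subr0 -[LHS]mulrA -expRD [RHS]mulrA.
  congr (_ * _).
    rewrite /normal_peak [in RHS]exprMn -[in RHS]mulrA -[in RHS]mulrnAr.
    rewrite [in RHS]sqrtrM ?sqr_ge0// sqrtr_sqr gtr0_norm// invfM mulrA.
    by rewrite mulfV ?gt_eqF// mul1r.
  congr expR; field.
  by rewrite !gt_eqF.
rewrite ge0_integralZl ?lee_fin ?ltW//.
- by rewrite integral_normal_pdf mule1.
- by apply/measurable_EFinP; exact: measurable_normal_pdf.
- by move=> x _; rewrite lee_fin normal_pdf_ge0.
Qed.

(** * Euclidean norm and an exponential bound *)

Lemma enorm_ge0 (R : realType) (n : nat) (x : 'rV[R]_n) : 0 <= enorm x.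
Proof. exact: sqrtr_ge0. Qed.

Lemma sqr_enorm (R : realType) (n : nat) (x : 'rV[R]_n) :
  enorm x ^+ 2 = \sum_(i < n) x ord0 i ^+ 2.
Proof. by rewrite sqr_sqrtr// sumr_ge0// => i _; exact: sqr_ge0. Qed.

Lemma enormD (R : realType) (n : nat) (x y : 'rV[R]_n) :
  enorm (x + y) <= enorm x + enorm y.
Proof.
(* The weighted AM-GM below divides by both norms, so zero vectors are settled first. *)
have enorm0 (u : 'rV[R]_n) : enorm u = 0 -> u = 0.
  move=> u0; have := sqr_enorm _ _ u; rewrite u0 expr0n/= => /esym/eqP.
  rewrite psumr_eq0 => [/allP/= H|i _]; last exact: sqr_ge0.
  apply/rowP => i; rewrite mxE; apply/eqP.
  by rewrite -sqrf_eq0 H// mem_index_enum.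
have [/enorm0 ->|x0] := eqVneq (enorm x) 0.
  by rewrite add0r lerDr enorm_ge0.
have [/enorm0 ->|y0] := eqVneq (enorm y) 0.
  by rewrite addr0 lerDl enorm_ge0.
have a0 : 0 < enorm x by rewrite lt_neqAle eq_sym x0 enorm_ge0.
have b0 : 0 < enorm y by rewrite lt_neqAle eq_sym y0 enorm_ge0.
rewrite -(@ler_pXn2r _ 2%N)// ?nnegrE ?addr_ge0 ?enorm_ge0//.
rewrite sqr_enorm.
(* AM-GM: 2 u v <= (b / a) u^2 + (a / b) v^2 with a = |x| and b = |y| *)
apply: (@le_trans _ _ (\sum_(i < n)
    ((1 + enorm y / enorm x) * x ord0 i ^+ 2
     + (1 + enorm x / enorm y) * y ord0 i ^+ 2))).
  apply: ler_sum => i _; rewrite mxE -subr_ge0.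
  set u := x _ _; set v := y _ _; set a := enorm x; set b := enorm y.
  rewrite (_ : _ - _ = (a * b)^-1 * (b * u - a * v) ^+ 2).
    by rewrite mulr_ge0 ?sqr_ge0// invr_ge0 mulr_ge0// ltW.
  by field; rewrite x0 y0.
rewrite big_split/= -!mulr_sumr -!sqr_enorm le_eqVlt; apply/orP; left.
by apply/eqP; field; rewrite x0 y0.
Qed.

(** Links the Euclidean norm to the sup norm, whose balls define neighbourhoods of row vectors. *)
Lemma enormB_le (R : realType) (n : nat) (x y : 'rV[R]_n) (e : R) :
  0 <= e -> (forall i, `|x ord0 i - y ord0 i| <= e) ->
  enorm (x - y) <= Num.sqrt n%:R * e.
Proof.
move=> e0 xye; rewrite -(@ler_pXn2r _ 2%N)// ?nnegrE ?mulr_ge0 ?enorm_ge0//.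
rewrite sqr_enorm exprMn sqr_sqrtr//.
apply: (@le_trans _ _ (\sum_(i < n) e ^+ 2)).
  apply: ler_sum => i _; rewrite !mxE -real_normK ?num_real//.
  by rewrite ler_pXn2r// nnegrE.
by rewrite sumr_const card_ord mulr_natl.
Qed.

(** The left side is a partial sum of a series with nonnegative terms. At [2 * y] it yields
    [a <= expR y] in the tail bound. *)
Lemma expR_ge_1DxDxx (R : realType) (x : R) : 0 <= x ->
  1 + x + x ^+ 2 / 2 <= expR x.
Proof.
move=> x0.
have nd : {homo series (exp_coeff x) : m n / (m <= n)%N >-> m <= n}.
  by move=> m n; apply: nondecreasing_series => k _ _; exact: exp_coeff_ge0.
apply: le_trans (nondecreasing_cvgn_le nd (is_cvg_series_exp_coeff x) 3).
rewrite /series/= !big_nat_recr//= big_geq// !exp_coeffE add0r.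
by rewrite !factS fact0 !expr0 expr1 !mulr1 !muln1 invr1 !mul1r mulrC.
Qed.

(** * Measurability through [vec] *)

(** Bridges the topology of row vectors and the product sigma-algebra of tuples: an open set is the
    countable union of the cubes inside it with rational centre and radius [1 / (k + 1)]. *)
Lemma open_measurable_vec (R : realType) (n : nat) (U : set 'rV[R]_n) :
  open U -> measurable [set x : n.-tuple R | U (vec x)].
Proof.
move=> oU.
pose B (c : n.-tuple rat * nat) : set (n.-tuple R) :=
  [set x | forall i, `|ratr (tnth c.1 i) - tnth x i| < c.2.+1%:R^-1].
have mB c : measurable (B c).
  apply: (measurable_box _ _ (fun i => ball (ratr (tnth c.1 i) : R) _)) => i.
  exact: measurable_ball.
pose S c : set (n.-tuple R) :=
  if `[< B c `<=` [set x | U (vec x)] >] then B c else set0.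
rewrite (_ : [set x | _] = \bigcup_c S c).
  apply: countable_bigcupT_measurable => [|c]; first exact: countableP.
  by rewrite /S; case: ifP.
apply/seteqP; split => [x /= Ux|x [c _]]; last first.
  by rewrite /S; case: ifPn => // /asboolP; exact.
have /nbhs_ballP[e /= e0 eU] := open_nbhs_nbhs (conj oU Ux).
(* A radius below [e / 2] keeps a cube containing [x] within distance [e] of [x]. *)
have [k] := ltr_add_invr (divr_gt0 e0 (ltr0n R 2)); rewrite add0r => ke.
have q i : {q : rat | `|ratr q - tnth x i| < k.+1%:R^-1}.
  apply: cid; have [q] : exists q : rat,
      ratr q \in `]tnth x i - k.+1%:R^-1, tnth x i + k.+1%:R^-1[.
    by apply: rat_in_itvoo; rewrite ltrD2l gtrN.
  by rewrite in_itv/= -ltr_distl => qx; exists q.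
pose c : n.-tuple rat * nat := ([tuple sval (q i) | i < n], k).
exists c => //; rewrite /S ifT.
  by move=> i; rewrite tnth_mktuple; case: (q i).
apply/asboolP => y By /=; apply: eU; split => // i j.
rewrite !mxE /ball/=.
have := By j; have := svalP (q j); rewrite tnth_mktuple/=.
move=> xq yq; rewrite (le_lt_trans (ler_distD (ratr (sval (q j))) _ _))//.
by rewrite (splitr e) ltrD ?(lt_trans _ ke)// distrC.
Qed.

Lemma continuous_measurable_vec (R : realType) (n : nat) (f : 'rV[R]_n -> R) :
  continuous f -> measurable_fun setT (fun x : n.-tuple R => f (vec x)).
Proof.
move=> cf; apply: (measurability _ (RGenOpens.measurableE R)).
move=> _ [_ [a [b ->]] <-]; rewrite setTI.
apply: (open_measurable_vec _ _ (f @^-1` `]a, b[)).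
by apply: open_comp => [x _|]; [exact: cf|exact: interval_open].
Qed.

Lemma hoelder_continuous (R : realType) (n : nat) (f : 'rV[R]_n -> R)
    (L alpha : R) : 0 < alpha ->
  (forall x y, `|f x - f y| <= L * enorm (x - y) `^ alpha) -> continuous f.
Proof.
move=> alpha0 fL x; apply/(@cvgrPdist_le _ _ _ (nbhs x) (nbhs_filter x)) => e e0.
(* Chosen so that [(|L| + 1) * c ^ alpha = e]; adding 1 keeps the divisor positive. *)
pose c : R := (e / (`|L| + 1)) `^ alpha^-1.
have L0 : 0 < `|L| + 1 by rewrite ltr_wpDl.
have c0 : 0 < c by rewrite powR_gt0// divr_gt0.
have s0 : 0 < Num.sqrt n%:R + 1 :> R by rewrite ltr_wpDl ?sqrtr_ge0.
(* A sup-norm radius that forces Euclidean distance at most [c]; the 1 covers [n = 0]. *)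
have r0 : 0 < c / (Num.sqrt n%:R + 1) by rewrite divr_gt0.
near=> y.
have xy : enorm (x - y) <= c.
  apply: le_trans (enormB_le _ _ _ _ _ (ltW r0) _) _.
    move=> i; apply/ltW.
    have : ball x (c / (Num.sqrt n%:R + 1)) y by near: y; exact: nbhsx_ballx.
    by move=> [_ /(_ ord0 i)].
  by rewrite mulrCA ler_piMr ?(ltW c0)// ler_pdivrMr// mul1r lerDl.
apply: (le_trans (fL x y)); apply: (@le_trans _ _ ((`|L| + 1) * c `^ alpha)).
  apply: (@le_trans _ _ ((`|L| + 1) * enorm (x - y) `^ alpha)).
    rewrite ler_wpM2r ?powR_ge0// (le_trans (ler_norm _))// lerDl//.
  rewrite ler_wpM2l ?(ltW L0)// ge0_ler_powR ?nnegrE ?enorm_ge0 ?(ltW c0)//.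
  exact: ltW.
have d0 : 0 <= e / (`|L| + 1) by rewrite divr_ge0// ltW.
by rewrite /c -powRrM mulVf ?gt_eqF// powRr1// mulrC divfK// gt_eqF.
Unshelve. all: end_near. Qed.

Lemma measurable_enorm_vec (R : realType) (n : nat) :
  measurable_fun setT (fun z : n.-tuple R => enorm (vec z)).
Proof.
apply: continuous_measurable_vec.
(* The reverse triangle inequality is a Hoelder bound with exponent 1. *)
apply: (@hoelder_continuous _ _ _ 1 1) => // x y.
rewrite mul1r powRr1 ?enorm_ge0// ler_norml lerBlDl lerNl opprB lerBlDl.
have enormN (u : 'rV[R]_n) : enorm (- u) = enorm u.
  by congr Num.sqrt; apply: eq_bigr => i _; rewrite mxE sqrrN.
have enormB (u v : 'rV[R]_n) : enorm u <= enorm v + enorm (u - v).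
  by rewrite -[u in leLHS](subrKC v) enormD.
by rewrite enormB -(enormN (x - y)) opprB enormB.
Qed.

Lemma measurable_enorm_vec_gt (R : realType) (n : nat) (t : R) :
  measurable [set z : n.-tuple R | t < enorm (vec z)].
Proof.
rewrite [X in measurable X](_ : _ =
    (fun z : n.-tuple R => enorm (vec z)) @^-1` `]t, +oo[).
  by rewrite -[X in measurable X]setTI; exact: measurable_enorm_vec.
by apply/seteqP; split => z /=; rewrite in_itv/= andbT.
Qed.

(** * Tail of the Gaussian norm *)

Lemma diag_normal_tail_ge (R : realType) (n : nat) (s a : R)
    (mu : probability (n.-tuple R) R) :
  0 < s -> 0 < n%:R * a ^+ 2 -> 1 <= a -> diag_normal 0 (const_mx s) mu ->
  (mu [set z | (s * Num.sqrt (n%:R * a ^+ 2) < enorm (vec z))%R] <=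
   (a ^+ n * expR (- (n%:R * (a ^+ 2 - 1) / 2)))%:E)%E.
Proof.
move=> s0 na a1 hmu; have a0 : 0 < a by exact: lt_le_trans a1.
set A := [set z | _].
have mA : measurable A by exact: measurable_enorm_vec_gt.
pose lam : R := (1 - a ^- 2) / (s ^+ 2 *+ 2).
have lam0 : 0 <= lam.
  rewrite divr_ge0 ?mulrn_wge0 ?sqr_ge0// subr_ge0 invf_le1 ?exprn_gt0//.
  by rewrite expr_ge1// ltW.
(* The product form gives the mean of [F] coordinate by coordinate; [FE] rewrites it as an
   increasing function of the norm, as Markov's inequality requires. *)
pose F (z : n.-tuple R) := \prod_(i < n) expR (lam * tnth z i ^+ 2).
have mF : measurable_fun setT F.
  apply: measurable_prod => i _; apply: measurableT_comp => //.
  apply: measurable_funM => //; apply: measurable_funX; exact: measurable_tnth.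
have IF : (\int[mu]_z (F z)%:E = (a ^+ n)%:E)%E.
  have := @integral_prod_box R n mu (fun=> normal_prob 0 s) _
    (fun=> fun x => expR (lam * x ^+ 2)) (fun=> a).
  rewrite prodr_const card_ord; apply => //.
  - move=> B mB; apply: (etrans (hmu B mB)); apply: eq_bigr => i _.
    by rewrite !mxE /normal_law gt_eqF.
  - by move=> i; apply: measurableT_comp => //; exact: measurable_funM.
  - by move=> i; exact: integral_normal_prob_expR_sqr.
have FE z : F z = expR (lam * enorm (vec z) ^+ 2).
  by rewrite sqr_enorm mulr_sumr expR_sum; apply: eq_bigr => i _; rewrite mxE.
rewrite mulrC expRN EFinM lee_pdivlMl ?expR_gt0// -IF.
rewrite -integral_cst//.
apply: (@le_trans _ _ (\int[mu]_(z in A) (F z)%:E)%E); last first.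
  apply: ge0_subset_integral => //; first exact/measurable_EFinP.
  by move=> z _; rewrite lee_fin FE expR_ge0.
apply: ge0_le_integral => //.
- by move=> z _; rewrite lee_fin expR_ge0.
- by apply/measurable_EFinP; exact: measurable_funTS.
- move=> z /= Az; rewrite lee_fin FE ler_expR.
  (* The exponent of [F] at the threshold radius. *)
  rewrite (_ : _ / 2 = lam * (s * Num.sqrt (n%:R * a ^+ 2)) ^+ 2).
    rewrite ler_wpM2l// ler_pXn2r ?nnegrE ?enorm_ge0 ?mulr_ge0 ?sqrtr_ge0 ?ltW//.
  rewrite exprMn sqr_sqrtr ?ltW// /lam; field.
  by rewrite !gt_eqF.
Qed.

(** For [s = 1] this is the Laurent-Massart upper tail of the chi-square law with [n] degrees of
    freedom. *)
Lemma diag_normal_tail (R : realType) (n : nat) (s x : R)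
    (mu : probability (n.-tuple R) R) :
  0 <= s -> 0 < x -> diag_normal 0 (const_mx s) mu ->
  (mu [set z | (s * Num.sqrt (n%:R + 2 * Num.sqrt (n%:R * x) + 2 * x)
                < enorm (vec z))%R] <= (expR (- x))%:E)%E.
Proof.
rewrite le_eqVlt => /predU1P[<-|s0] x0 hmu; last first.
  (* [y] divides by [n]. In dimension 0 the norm is 0 and the event is empty. *)
  have [n0|n0] := posnP n.
    rewrite [X in mu X](_ : _ = set0) ?measure0 ?lee_fin ?expR_ge0//.
    apply/seteqP; split => // z /=; rewrite [ltRHS](_ : _ = 0).
      by rewrite ltNge mulr_ge0 ?sqrtr_ge0// ltW.
    rewrite /enorm big1 ?sqrtr0// => i _; exfalso.
    by have := leq_ltn_trans (leq0n i) (ltn_ord i); rewrite lt0n n0.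
  have n0' : 0 < n%:R :> R by rewrite ltr0n.
  pose y : R := Num.sqrt (x / n%:R).
  pose a : R := Num.sqrt (1 + 2 * y + (2 * y) ^+ 2 / 2).
  have y0 : 0 <= y by exact: sqrtr_ge0.
  have y2 : n%:R * y ^+ 2 = x.
    by rewrite sqr_sqrtr ?divr_ge0 ?ltW// mulrC divfK// gt_eqF.
  have a2 : a ^+ 2 = 1 + 2 * y + 2 * y ^+ 2.
    by rewrite sqr_sqrtr; [field|nra].
  have a1 : 1 <= a.
    by rewrite -[leLHS]sqrtr1; apply: ler_wsqrtr; nra.
  rewrite (_ : n%:R + _ + _ = n%:R * a ^+ 2); last first.
    rewrite -y2 (_ : n%:R * (n%:R * y ^+ 2) = (n%:R * y) ^+ 2); last by ring.
    rewrite sqrtr_sqr ger0_norm ?mulr_ge0// ?ltW// a2; ring.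
  apply: (le_trans (diag_normal_tail_ge _ _ _ _ mu s0 _ a1 hmu)).
    by rewrite mulr_gt0// exprn_gt0// (lt_le_trans _ a1).
  have ay : a <= expR y.
    rewrite -(@ler_pXn2r _ 2%N)// ?nnegrE ?expR_ge0 ?(le_trans _ a1)//.
    rewrite -expRM_natl sqr_sqrtr; last by nra.
    by apply: expR_ge_1DxDxx; rewrite mulr_ge0.
  rewrite lee_fin; apply: (@le_trans _ _
      (expR y ^+ n * expR (- (n%:R * (a ^+ 2 - 1) / 2)))).
    rewrite ler_wpM2r ?expR_ge0// lerXn2r ?nnegrE ?expR_ge0//.
    exact: le_trans a1.
  (* The exponents add up to [n y - n (y + y^2) = - n y^2 = - x]. *)
  rewrite -expRM_natl -expRD ler_expR a2 -y2 le_eqVlt.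
  by apply/orP; left; apply/eqP; field.
(* For [s = 0] the law is concentrated at the origin, and the event lies in the complement of this
   box of mass 1. *)
pose B : set (n.-tuple R) := [set z | forall i, [set 0] (tnth z i)].
have mB : measurable B.
  by apply: (measurable_box _ _ (fun=> [set 0])) => i.
have muB : mu B = 1%E.
  apply: (etrans (hmu _ (fun=> measurable_set1 0))).
  apply: big1 => i _; rewrite !mxE /normal_law eqxx diracE.
  by rewrite mem_set.
apply: (@le_trans _ _ (mu (~` B))).
  apply: le_measure; rewrite ?inE; [exact: measurable_enorm_vec_gt| exact: measurableC|].
  move=> z /=; rewrite mul0r => z0 zB; move: z0.
  rewrite /enorm big1 ?sqrtr0 ?ltxx// => i _.
  by rewrite mxE zB expr0n.
by rewrite probability_setC// muB subee// lee_fin expR_ge0.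
Qed.

Theorem theorem1 (R : realType) (d dVAE m : nat)
  (* reward MLPs and the best possible reward function *)
  (widths : seq nat) (act : R -> R) (hact : measurable_fun setT act)
  (Ro : set 'rV[R]_(mlp_size d widths)) (ro : 'rV[R]_(mlp_size d widths)) (s1 : R)
  (Pe : probability (d.-tuple R * d.-tuple R)%type R)
  (rstar : 'rV[R]_(mlp_size d widths))
  (hrstar : is_argmin Ro (fun r => preference_risk Pe (mlp act r)) rstar)
  (* VAE trained on a dataset of N preference pairs, for every N *)
  (Theta : set 'rV[R]_m) (theta0 : 'rV[R]_m) (s2 : R)
  (g : 'rV[R]_m -> 'rV[R]_dVAE -> 'rV[R]_d)
  (ep em : forall N : nat, 'I_N -> 'rV[R]_d)
  (theta : nat -> 'rV[R]_m) (htheta : forall N, Theta (theta N))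
  (mean sd : nat -> 'rV[R]_d -> 'rV[R]_dVAE)
  (q : nat -> 'rV[R]_d -> probability (dVAE.-tuple R) R)
  (hq : forall N e, diag_normal (mean N e) (sd N e) (q N e))
  (sigma_noise : R) (hsigma : 0 <= sigma_noise)
  (alpha Lr Lg : R) (eps_rec : nat -> R)
  (halpha : 0 < alpha <= 1) (hLr : 0 < Lr) (hLg : 0 < Lg)
  (hi : Ro `<=` eball ro s1)
  (hii : Theta `<=` eball theta0 s2)
  (hiii : forall e1 e2 : 'rV[R]_d,
     `|mlp act rstar e1 - mlp act rstar e2| <= Lr * enorm (e1 - e2) `^ alpha)
  (hiv : forall N (z1 z2 : 'rV[R]_dVAE),
     enorm (g (theta N) z1 - g (theta N) z2) <= Lg * enorm (z1 - z2))
  (hv : forall N e, preference_dataset (ep N) (em N) e ->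
     {ae q N e, forall z, enorm (g (theta N) (vec z) - e) <= eps_rec N})
  (hvi : exists2 p : R, 0 < p & eps_rec =O_\oo (fun N : nat => N%:R `^ (- p)))
  (delta : R) (hdelta : 0 < delta < 1) :
  forall (N : nat) (i : 'I_N)
    (* a synthesized pair: latent vectors of the i-th original pair, and noise *)
    (disp : measure_display) (Omega : measurableType disp)
    (P : probability Omega R)
    (zp zm etap etam : {RV P >-> dVAE.-tuple R}),
    has_law zp (q N (ep N i)) -> has_law zm (q N (em N i)) ->
    diag_normal 0 (const_mx sigma_noise) (distribution P etap) ->
    diag_normal 0 (const_mx sigma_noise) (distribution P etam) ->
    let synp (w : Omega) := g (theta N) (vec (zp w) + vec (etap w)) in
    let synm (w : Omega) := g (theta N) (vec (zm w) + vec (etam w)) in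
    ((1 - delta)%:E <=
     P [set w | (mlp act rstar (ep N i) - mlp act rstar (em N i)
                 - 2 * Lr * (Lg * t_delta sigma_noise delta dVAE
                             + eps_rec N) `^ alpha
                 <= mlp act rstar (synp w) - mlp act rstar (synm w))%R])%E.
Proof.
move=> N i disp Omega P zp zm etap etam hzp hzm hetap hetam /=.
pose synp w := g (theta N) (vec (zp w) + vec (etap w)).
pose synm w := g (theta N) (vec (zm w) + vec (etam w)).
have /andP[alpha0 _] := halpha; have /andP[delta0 delta1] := hdelta.
set r := mlp act rstar; set t := t_delta sigma_noise delta dVAE.
(* Composing the Hoelder reward with the Lipschitz decoder gives a Hoelder function of the latent
   vector, whence the measurability of the good event. *)
have r_cont : continuous (fun z => r (g (theta N) z)).
  apply: (@hoelder_continuous _ _ _ (Lr * Lg `^ alpha) alpha) => // x y.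
  apply: (le_trans (hiii _ _)).
  rewrite -mulrA -powRM ?enorm_ge0 ?(ltW hLg)//.
  rewrite ler_wpM2l ?(ltW hLr)// ge0_ler_powR ?nnegrE ?enorm_ge0 ?(ltW alpha0)//.
  by rewrite mulr_ge0 ?enorm_ge0// ltW.
have m_syn (z eta : {RV P >-> dVAE.-tuple R}) :
    measurable_fun setT (fun w => r (g (theta N) (vec (z w) + vec (eta w)))).
  pose ze w : dVAE.-tuple R := [tuple tnth (z w) j + tnth (eta w) j | j < dVAE].
  rewrite [X in measurable_fun _ X](_ : _ =
      (fun x : dVAE.-tuple R => r (g (theta N) (vec x))) \o ze); last first.
    apply/funext => w /=; congr (r (g _ _)); apply/rowP => j.
    by rewrite !mxE tnth_mktuple.
  apply: (measurableT_comp (continuous_measurable_vec _ _ _ r_cont)).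
  apply/measurable_fun_tnthP => j.
  rewrite [X in measurable_fun _ X](_ : _ =
      (fun w => tnth (z w) j + tnth (eta w) j)); last first.
    by apply/funext => w /=; rewrite tnth_mktuple.
  by apply: measurable_funD; apply: (measurableT_comp (measurable_tnth j)).
set Good := [set w | _].
have mGood : measurable Good.
  rewrite [Good](_ : _ = (fun w => r (synp w) - r (synm w)) @^-1`
    `[r (ep N i) - r (em N i) - 2 * Lr * (Lg * t + eps_rec N) `^ alpha, +oo[).
    rewrite -[X in measurable X]setTI.
    by apply: measurable_funB => //; exact: m_syn.
  by apply/seteqP; split => w /=; rewrite in_itv/= andbT.
(* One side of the pair. [B] joins the null set of badly reconstructed latent vectors to the noise
   tail, which has mass at most [exp (- ln (4 / delta)) = delta / 4]. *)
have bad e (z eta : {RV P >-> dVAE.-tuple R}) :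
    preference_dataset (ep N) (em N) e -> has_law z (q N e) ->
    diag_normal 0 (const_mx sigma_noise) (distribution P eta) ->
    exists B, [/\ measurable B, (P B <= (delta / 4)%:E)%E &
      forall w, ~ B w -> `|r (g (theta N) (vec (z w) + vec (eta w))) - r e|
        <= Lr * (Lg * t + eps_rec N) `^ alpha].
  move=> he hz heta; have [A [mA A0 subA]] := hv N e he.
  pose C : set (dVAE.-tuple R) := [set x | t < enorm (vec x)].
  have mC : measurable C by exact: measurable_enorm_vec_gt.
  have mzA : measurable (z @^-1` A).
    by rewrite -[X in measurable X]setTI; exact: measurable_funPT.
  have metaC : measurable (eta @^-1` C).
    by rewrite -[X in measurable X]setTI; exact: measurable_funPT.
  exists (z @^-1` A `|` eta @^-1` C); split; first exact: measurableU.
    apply: (le_trans (measureU2 P mzA metaC)).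
    (* Makes [ln (4 / delta)] positive, as the tail bound requires. *)
    have d4 : 1 < 4 / delta by rewrite ltr_pdivlMr// mul1r; lra.
    have Ceta := diag_normal_tail _ _ _ _ _ hsigma (ln_gt0 d4) heta.
    rewrite -[leRHS]add0e; apply: leeD; first by rewrite -A0 -(hz A mA).
    by rewrite expRN lnK ?posrE ?divr_gt0// invf_div in Ceta.
  move=> w /not_orP[zA etaC].
  have rec : enorm (g (theta N) (vec (z w)) - e) <= eps_rec N.
    by apply: contrapT => h; apply: zA; apply: subA.
  have {etaC} eta_t : enorm (vec (eta w)) <= t by rewrite leNgt; apply/negP.
  apply: (le_trans (hiii _ _)); rewrite ler_wpM2l ?(ltW hLr)//.
  have syn_e : enorm (g (theta N) (vec (z w) + vec (eta w)) - e)
      <= Lg * t + eps_rec N.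
    rewrite -(subrKA (g (theta N) (vec (z w)))).
    apply: (le_trans (enormD _ _ _ _)); apply: lerD => //.
    apply: (le_trans (hiv _ _ _)); rewrite addrC addKr.
    by rewrite ler_pM2l.
  (* Monotonicity of the power needs a nonnegative base; [Lg * t + eps_rec N] is one because it
     dominates a norm. *)
  rewrite ge0_ler_powR ?nnegrE ?enorm_ge0 ?(ltW alpha0)//.
  exact: le_trans (enorm_ge0 _ _ _) syn_e.
have [Bp [mBp PBp Bp_le]] :=
  bad _ zp etap (or_introl (ex_intro2 _ _ i I erefl)) hzp hetap.
have [Bm [mBm PBm Bm_le]] :=
  bad _ zm etam (or_intror (ex_intro2 _ _ i I erefl)) hzm hetam.
have mB : measurable (Bp `|` Bm) by exact: measurableU.
(* A union bound, valid whatever the dependence between latent and noise vectors. *)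
apply: (@le_trans _ _ (P (~` (Bp `|` Bm)))).
  rewrite probability_setC// EFinB leeB//.
  apply: (le_trans (measureU2 P mBp mBm)).
  apply: (le_trans (leeD PBp PBm)); rewrite -EFinD lee_fin; lra.
apply: le_measure; rewrite ?inE//; first exact: measurableC.
move=> w /not_orP[/Bp_le + /Bm_le]; rewrite -/(synp w) -/(synm w) /Good/=.
rewrite !ler_norml => /andP[+ _] /andP[_]; lra.
Qed.
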